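(* Let $a>0$, let $g_0,g_1\in C^1([0,1])$, and let $\Delta$ be an admissible set of initial conditions for the nonlocal problem (N) (see context). Suppose that $$\left(\int_0^1g_0^2(z)dz\right)^{1/2}+\left(\int_0^1g_1^2(z)dz\right)^{1/2}<\sqrt3.$$ Then there exist constants $M,\delta>0$ such that for every $x_0\in\Delta$ the unique solution $x$ of (N) with initial condition $x_0$ satisfies, for all $t\ge0$, $$\|x[t]\|_2\le M e^{-\delta t}\|x[0]\|_2,$$ where $\|x[t]\|_2:=\left(\int_0^1|x(t,z)|^2dz\right)^{1/2}$.
   Context: $\mathbb{R}_+=[0,+\infty)$. For a function $x$ on $\mathbb{R}_+\times[0,1]$, $x[t]$ denotes the profile $z\mapsto x(t,z)$. Problem (N): $\frac{\partial x}{\partial t}(t,z)=a\frac{\partial^2x}{\partial z^2}(t,z)$ for $(t,z)\in(0,+\infty)\times(0,1)$, with nonlocal boundary conditions $x(t,0)=\int_0^1g_0(z)x(t,z)dz$ and $x(t,1)=\int_0^1g_1(z)x(t,z)dz$ for $t\ge 0$. A solution with initial condition $x_0$ is a function $x\in C^0(\mathbb{R}_+\times[0,1])\cap C^1((0,+\infty)\times[0,1])$ satisfying these, with $x[t]\in C^2([0,1])$ for all $t\ge0$ and $x(0,z)=x_0(z)$ for all $z\in[0,1]$. Standing assumption: there exists an admissible set of initial conditions $\Delta$, i.e. a non-empty set $$\Delta\subseteq\left\{x\in C^2([0,1]):x(0)-\int_0^1g_0(z)x(z)dz=x(1)-\int_0^1g_1(z)x(z)dz=0\right\}$$ which is dense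 in $L^2$ (i.e. $L^2(0,1)$) and such that for every $x_0\in\Delta$ problem (N) with initial condition $x_0$ has a unique solution. *)

(* Defs.v *)
From HB Require Import structures.
From mathcomp Require Import all_boot all_order all_algebra.
From mathcomp Require Import all_classical all_reals all_analysis.
Set Implicit Arguments.
Unset Strict Implicit.
Unset Printing Implicit Defensive.
Import Order.TTheory GRing.Theory Num.Theory.
Import numFieldNormedType.Exports.
Local Open Scope classical_set_scope.
Local Open Scope ring_scope.

(* Functions on [0,1] (resp. on [0,+oo[ x [0,1]) are represented by total
   functions R -> R (resp. R -> R -> R, time first); every notion below only
   depends on their values on the relevant domain. *)

(* The increments stay in D, so that the derivative is one-sided at the end
   points when D is a closed interval. *)
Definition has_deriv_within (R : realType) (D : set R) (f : R -> R) (z l : R)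
    : Prop :=
  (f y - f z) / (y - z) @[y --> within D z^'] --> l.

Fixpoint Ck_on (R : realType) (k : nat) (D : set R) (f : R -> R) : Prop :=
  match k with
  | 0%N => {within D, continuous f}
  | k'.+1 => exists f' : R -> R,
      (forall z, D z -> has_deriv_within D f z (f' z)) /\ Ck_on k' D f'
  end.

(* Class C^1 on ]0,+oo[ x [0,1]: both first partial derivatives exist there
   (one-sided in z at z = 0 and z = 1) and are jointly continuous there. *)
Definition C1_space_time (R : realType) (x : R -> R -> R) : Prop :=
  exists xt xz : R -> R -> R,
    [/\ forall (t z : R), 0 < t -> z \in `[0, 1] ->
          is_derive t 1 (x ^~ z) (xt t z)
          /\ has_deriv_within `[0, 1] (x t) z (xz t z),
        {within `]0, +oo[ `*` `[0, 1], continuous (fun p : R * R => xt p.1 p.2)}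
      & {within `]0, +oo[ `*` `[0, 1], continuous (fun p : R * R => xz p.1 p.2)}].

Definition int01 (R : realType) (f : R -> R) : R :=
  \int[lebesgue_measure]_(z in `[0, 1]) f z.

Definition l2norm (R : realType) (f : R -> R) : R :=
  Num.sqrt (int01 (fun z => `|f z| ^+ 2)).

(* At an interior point z of [0,1] the two-sided derivatives of the library
   exist for x[t] in C^2([0,1]) and agree with those of Ck_on. *)
Definition is_solution (R : realType) (a : R) (g0 g1 : R -> R) (x0 : R -> R)
    (x : R -> R -> R) : Prop :=
  {within `[0, +oo[ `*` `[0, 1], continuous (fun p : R * R => x p.1 p.2)}
  /\ C1_space_time x
  /\ (forall t : R, 0 <= t -> Ck_on 2 `[0, 1] (x t))
  /\ (forall (t z : R), 0 < t -> z \in `]0, 1[ ->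
        derive1 (x ^~ z) t = a * derive1n 2 (x t) z)
  /\ (forall t : R, 0 <= t -> x t 0 = int01 (fun z => g0 z * x t z))
  /\ (forall t : R, 0 <= t -> x t 1 = int01 (fun z => g1 z * x t z))
  /\ (forall z : R, z \in `[0, 1] -> x 0 z = x0 z).

Definition has_unique_solution (R : realType) (a : R) (g0 g1 : R -> R)
    (x0 : R -> R) : Prop :=
  exists x, is_solution a g0 g1 x0 x
    /\ forall y, is_solution a g0 g1 x0 y ->
         forall (t z : R), 0 <= t -> z \in `[0, 1] -> y t z = x t z.

(* L^2(0,1) is Lfun for the Lebesgue measure restricted to ]0,1[. *)
Definition dense_in_L2 (R : realType) (Delta : set (R -> R)) : Prop :=
  forall f : R -> R,
    f \in Lfun (mrestr (@lebesgue_measure R)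
                  (measurable_itv (`]0, 1[ : interval R))) 2%:E ->
    forall eps : R, 0 < eps ->
      exists x : R -> R, Delta x /\ l2norm (fun z => f z - x z) < eps.

Definition admissible (R : realType) (a : R) (g0 g1 : R -> R)
    (Delta : set (R -> R)) : Prop :=
  [/\ Delta !=set0,
      Delta `<=` [set x | Ck_on 2 `[0, 1] x
                    /\ x 0 - int01 (fun z => g0 z * x z) = 0
                    /\ x 1 - int01 (fun z => g1 z * x z) = 0],
      dense_in_L2 Delta
    & forall x0, Delta x0 -> has_unique_solution a g0 g1 x0].

(* Main.v *)
Require Import Defs.
From mathcomp Require Import all_boot all_order all_algebra.
From mathcomp Require Import all_classical all_reals all_analysis.
From mathcomp Require Import ring lra.
Import Order.TTheory GRing.Theory Num.Theory.
Import numFieldNormedType.Exports.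
Local Open Scope classical_set_scope.
Local Open Scope ring_scope.

(** The proof is a small-gain argument on the boundary values. Seen as inputs of
    the Dirichlet problem, boundary values bounded by [p] at 0 and by [q] at 1
    can, apart from a decaying transient, only force a solution that lies below
    the stationary profile [p (1 - z) + q z], whose L^2 norm is at most
    [(p + q) / sqrt 3]. Here the boundary values are fed back from the solution:
    by Cauchy-Schwarz [p <= |g0| N] and [q <= |g1| N], with [N] the L^2 norm of
    the current state. So the loop has gain [(|g0| + |g1|) / sqrt 3 < 1].

    To get a rate, put [X t z = exp (delta t) * x t z] and let [P] be the maximum
    over [[0, T]] of the L^2 norm of [X t]. The stationary profile is replaced by
    the concave barrier [Psi = |g0| (1 - z) + |g1| z + k z (1 - z)], whose
    curvature makes up for the term [delta P Psi] that the weight brings in. Both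
    [X - P Psi] and [- X - P Psi] are then subsolutions, nonpositive on the
    boundary, and the L^2 norms of their positive parts do not increase
    (Stampacchia's truncation): this is [softsq_energy_le], applied in
    [solution_comparison]. Since [|X| <= P Psi + (|X| - P Psi)^+] and the last
    term starts below [|x 0|], Young's inequality at the time where [P] is
    attained gives
    [P^2 <= (1 + r) |Psi|^2 P^2 + (1 + 1/r) |x 0|^2] ([solution_sqr_le]). For
    small [k] and [r] the factor of [P^2] on the right is less than 1, and [P] is
    bounded by a constant times [|x 0|].

    The squared positive part is only C^1, so the energy estimate is carried out
    for a C^2 regularization [softsq eta] and [eta] tends to 0 at the end
    ([int01_sqr_le_excess]). The decay of the energy needs a Poincare inequality
    compatible with this regularization ([int01_softsq_poincare]). *)

Set Implicit Arguments.
Unset Strict Implicit.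
Unset Printing Implicit Defensive.

Local Notation C01 f := {within `[0, 1], continuous f}.

(** * Continuity relative to a set *)

Lemma within_comp {U V W : topologicalType} (A : set U) (B : set V)
    (f : U -> V) (g : V -> W) :
  {within B, continuous g} -> {within A, continuous f} ->
  (forall x, A x -> B (f x)) -> {within A, continuous (g \o f)}.
Proof.
move=> /subspace_continuousP cg /subspace_continuousP cf AB.
apply/subspace_continuousP => x Ax.
apply: (@cvg_comp _ _ _ f g _ (within B (nbhs (f x)))); last exact: (cg _ (AB _ Ax)).
move=> P /= BP; have := cf x Ax _ BP; rewrite /= /nbhs /= /within /=.
by apply: filterS => z /= h Az; exact: h (AB _ Az).
Qed.

Lemma within_pair {U V W : topologicalType} (A : set U) (f : U -> V)
    (g : U -> W) : {within A, continuous f} -> {within A, continuous g} ->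
  {within A, continuous (fun x => (f x, g x))}.
Proof. by move=> cf cg x; apply: cvg_pair; [exact: cf|exact: cg]. Qed.

Section arith.
Context {T : topologicalType} {R : realType} (A : set T).
Implicit Types f g : T -> R.

Lemma within_cst (c : R) : {within A, continuous (fun _ : T => c)}.
Proof. by move=> x; exact: cvg_cst. Qed.

Lemma within_add f g : {within A, continuous f} -> {within A, continuous g} ->
  {within A, continuous (fun x => f x + g x)}.
Proof. by move=> cf cg x; apply: cvgD; [exact: cf|exact: cg]. Qed.

Lemma within_sub f g : {within A, continuous f} -> {within A, continuous g} ->
  {within A, continuous (fun x => f x - g x)}.
Proof. by move=> cf cg x; apply: cvgB; [exact: cf|exact: cg]. Qed.

Lemma within_mul f g : {within A, continuous f} -> {within A, continuous g} ->
  {within A, continuous (fun x => f x * g x)}.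
Proof. by move=> cf cg x; apply: cvgM; [exact: cf|exact: cg]. Qed.

Lemma within_post f (h : R -> R) : continuous h -> {within A, continuous f} ->
  {within A, continuous (fun x => h (f x))}.
Proof. by move=> ch cf x; apply: cvg_comp; [exact: cf|exact: ch]. Qed.

End arith.

(** * Integration over the unit interval *)

Section int01.
Context {R : realType}.
Implicit Types f g : R -> R.

Lemma C01_integrable f : C01 f ->
  (@lebesgue_measure R).-integrable `[0, 1] (EFin \o f).
Proof. by move=> cf; apply: continuous_compact_integrable => //; exact: segment_compact. Qed.

Lemma int01_ge0 f : (forall z, z \in `[0, 1] -> 0 <= f z) -> 0 <= int01 f.
Proof. by move=> f0; apply: Rintegral_ge0 => z zI; exact: f0. Qed.

Lemma eq_int01 f g : (forall z, z \in `[0, 1] -> f z = g z) -> int01 f = int01 g.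
Proof. by move=> fg; apply: eq_Rintegral => z /set_mem; exact: fg. Qed.

Lemma int01_le f g : C01 f -> C01 g ->
  (forall z, z \in `[0, 1] -> f z <= g z) -> int01 f <= int01 g.
Proof.
by move=> cf cg fg; apply: le_Rintegral => //; exact: C01_integrable.
Qed.

Lemma int01D f g : C01 f -> C01 g ->
  int01 (fun z => f z + g z) = int01 f + int01 g.
Proof. by move=> cf cg; apply: RintegralD => //; exact: C01_integrable. Qed.

Lemma int01Z (c : R) f : C01 f -> int01 (fun z => c * f z) = c * int01 f.
Proof. by move=> cf; apply: RintegralZl => //; exact: C01_integrable. Qed.

Lemma int01_FTC (F f : R -> R) : C01 F -> C01 f ->
  (forall z : R, z \in `]0, 1[ -> is_derive z 1 F (f z)) -> int01 f = F 1 - F 0.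
Proof.
move=> cF cf dF; rewrite /int01 /Rintegral (@continuous_FTC2 _ f F 0 1)//=.
- have /continuous_within_itvP := cF => /(_ ltr01)[_ F0 F1]; split => // z zI.
  by have [] := dF _ zI.
- by move=> z zI; rewrite derive1E; have [_ ->] := dF _ zI.
Qed.

(** The square [(l f - m g)^2] integrates to a nonnegative quadratic form in
    [(l, m)]; evaluating it at [(I, F)] bounds [I^2] by [F * G], and the
    degenerate case [F = 0] is settled by [(G + 1, I)]. *)
Lemma int01_CauchySchwarz f g : C01 f -> C01 g ->
  int01 (fun z => f z * g z) <=
  Num.sqrt (int01 (fun z => f z ^+ 2)) * Num.sqrt (int01 (fun z => g z ^+ 2)).
Proof.
move=> cf cg; set F := int01 (fun z => f z ^+ 2); set G := int01 (fun z => g z ^+ 2).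
set I := int01 _.
have cff : C01 (fun z => f z ^+ 2) by exact: within_mul.
have cgg : C01 (fun z => g z ^+ 2) by exact: within_mul.
have cfg : C01 (fun z => f z * g z) by exact: within_mul.
have F0 : 0 <= F by apply: int01_ge0 => z _; exact: sqr_ge0.
have G0 : 0 <= G by apply: int01_ge0 => z _; exact: sqr_ge0.
have H (l m : R) : 2 * (l * m * I) <= l ^+ 2 * F + m ^+ 2 * G.
  rewrite mulrA /F /G /I -(int01Z _ cff) -(int01Z _ cgg) -(int01Z _ cfg).
  have cZ c (h : R -> R) : C01 h -> C01 (fun z => c * h z).
    by move=> ch; apply: within_mul => //; exact: within_cst.
  rewrite -int01D; [|exact: cZ..].
  apply: int01_le => [| |z _]; [exact: cZ|by apply: within_add; exact: cZ|].
  by have := sqr_ge0 (l * f z - m * g z); nra.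
have [I0|I0] := leP I 0; first by rewrite (le_trans I0)// mulr_ge0// sqrtr_ge0.
rewrite -sqrtrM// -[leLHS]gtr0_norm// -sqrtr_sqr ler_wsqrtr//.
have [F_eq0|F_neq0] := eqVneq F 0.
  by have := H (G + 1) I; rewrite F_eq0; nra.
have Fgt0 : 0 < F by rewrite lt0r F_neq0.
by have := H I F; nra.
Qed.
End int01.

Section l2.
Context {R : realType}.

Lemma l2normE (f : R -> R) : l2norm f = Num.sqrt (int01 (fun z => f z ^+ 2)).
Proof.
by rewrite /l2norm; congr Num.sqrt; apply: eq_int01 => z _; rewrite real_normK// num_real.
Qed.

Lemma l2norm_ge0 (f : R -> R) : 0 <= l2norm f.
Proof. exact: sqrtr_ge0. Qed.

Lemma sqr_l2norm (f : R -> R) : l2norm f ^+ 2 = int01 (fun z => f z ^+ 2).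
Proof. by rewrite l2normE sqr_sqrtr// int01_ge0// => z _; exact: sqr_ge0. Qed.

Lemma norm_int01_le (f g : R -> R) : C01 f -> C01 g ->
  `|int01 (fun z => f z * g z)| <= l2norm f * l2norm g.
Proof.
move=> cf cg; rewrite !l2normE ler_norml int01_CauchySchwarz// andbT.
have cNg : C01 (fun z => - g z) by move=> x; apply: cvgN; exact: cg.
have cfg : C01 (fun z => f z * g z) by exact: within_mul.
have := int01_CauchySchwarz cf cNg.
under [X in _ <= _ * Num.sqrt X]eq_int01 do rewrite sqrrN.
have -> : int01 (fun z => f z * - g z) = - int01 (fun z => f z * g z).
  rewrite -mulN1r -int01Z//; apply: eq_int01 => z _; ring.
by rewrite lerNl.
Qed.

End l2.

(** * Integrals depending on a parameter *)

Section parametric.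
Context {R : realType}.
Local Notation uncurried F := (fun p : R * R => F p.1 p.2).

Lemma within_slice (F : R -> R -> R) (A B : set R) (t : R) : A t ->
  {within A `*` B, continuous (uncurried F)} -> {within B, continuous (F t)}.
Proof.
move=> At cF; apply: (within_comp (f := fun z => (t, z)) cF).
  by apply: within_pair; [exact: within_cst|apply: continuous_subspaceT => x; exact: cvg_id].
by [].
Qed.

Lemma rect_bounded (F : R -> R -> R) (u v : R) : u <= v ->
  {within `[u, v] `*` `[0, 1], continuous (uncurried F)} ->
  exists C : R,
    forall t z : R, t \in `[u, v] -> z \in `[0, 1] -> `|F t z| <= C.
Proof.
move=> uv cF; have cK : compact (`[u, v] `*` `[0, 1] : set (R * R)).
  by apply: compact_setX; exact: segment_compact.
have K0 : (`[u, v] `*` `[0, 1] : set (R * R)) !=set0.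
  by exists (u, 0); split => /=; rewrite in_itv/= lexx ?uv ?ler01.
have cN := within_post (@norm_continuous R R) cF.
have [c _ cmax] := compact_EVT_max K0 cK cN.
exists `|F c.1 c.2| => t z tI zI.
by apply: (cmax (t, z)); rewrite inE.
Qed.

(** The parameter is clamped to [[u, v]], so that the integrand becomes
    continuous in it on the whole line, as dominated convergence requires. *)
Lemma int01_continuous (F : R -> R -> R) (u v : R) : u <= v ->
  {within `[u, v] `*` `[0, 1], continuous (uncurried F)} ->
  {within `[u, v], continuous (fun t => int01 (F t))}.
Proof.
move=> uv cF; have [C CF] := rect_bounded uv cF.
pose c t := Num.max u (Num.min t v).
have cuv t : c t \in `[u, v].
  by rewrite in_itv/= /c le_max lexx ge_max uv/= ge_min lexx orbT.
have c_id t : t \in `[u, v] -> c t = t.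
  by rewrite in_itv/= /c => /andP[ut tv]; rewrite min_l// max_r.
have cc : continuous c.
  move=> t; apply: (@continuous_max _ _ (cst u) (id \min cst v)).
    exact: cvg_cst.
  by apply: continuous_min; [exact: cvg_id|exact: cvg_cst].
have cFc t : {within `[0, 1], continuous (F (c t))}.
  exact: within_slice (cuv t) cF.
have cFz z : z \in `[0, 1] -> continuous (fun t => F (c t) z).
  move=> zI; apply/continuous_subspace_setT.
  apply: (within_comp (f := fun t => (c t, z)) cF); last first.
    by move=> t _; split => //=; exact: cuv.
  by apply: within_pair; [exact: continuous_subspaceT|exact: within_cst].
have H1 t : t \in `]u - 1, v + 1[ ->
    (@lebesgue_measure R).-integrable `[0, 1] (EFin \o F (c t)).
  by move=> _; exact: C01_integrable.
have H2 : {ae @lebesgue_measure R, forall z, `[0, 1]%classic z ->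
    {in `]u - 1, v + 1[%classic, continuous (fun t => F (c t) z)}}.
  by apply: aeW => z zI t _; exact: cFz.
have H3 : (@lebesgue_measure R).-integrable `[0, 1] (EFin \o cst C).
  by apply: C01_integrable; exact: within_cst.
have H4 t : t \in `]u - 1, v + 1[ ->
    {ae @lebesgue_measure R, forall z, `[0, 1]%classic z -> `|F (c t) z| <= cst C z}.
  by move=> _; apply: aeW => z zI; exact: CF.
have h := @continuity_under_integral R _ _ (@lebesgue_measure R)
  (fun t => F (c t)) _ (measurable_itv _) _ _ H1 H2 _ H3 H4.
apply: (@subspace_eq_continuous _ _ _ (fun t => int01 (F (c t)))).
  by move=> t /set_mem /= /c_id; rewrite /from_subspace => ->.
apply: continuous_in_subspaceT => t /set_mem /= tI; apply: h.
by apply/mem_set; move: tI; rewrite /= !in_itv/=; lra.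
Qed.

(** Compactness of the rectangle gives the uniform bound on the partial
    derivative that justifies differentiation under the integral sign. *)
Lemma int01_is_derive (F Ft : R -> R -> R) (u v t : R) : t \in `]u, v[ ->
  (forall s, s \in `[u, v] -> {within `[0, 1], continuous (F s)}) ->
  {within `[u, v] `*` `[0, 1], continuous (uncurried Ft)} ->
  (forall s z : R, s \in `]u, v[ -> z \in `[0, 1] ->
    is_derive s 1 (F ^~ z) (Ft s z)) ->
  is_derive t 1 (fun s => int01 (F s)) (int01 (Ft t)).
Proof.
move=> tI cF cFt dF.
have uv : u <= v by move: tI; rewrite in_itv/=; lra.
have [C CF] := rect_bounded uv cFt.
have sub s : s \in `]u, v[ -> s \in `[u, v] by rewrite !in_itv/=; lra.
have p1E s z : s \in `]u, v[ -> z \in `[0, 1] -> partial1of2 F s z = Ft s z.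
  by move=> sI zI; rewrite partial1of2E; have [_ ->] := dF s z sI zI.
have H1 s : s \in `]u, v[ -> (@lebesgue_measure R).-integrable `[0, 1] (EFin \o F s).
  by move=> sI; apply: C01_integrable; apply: cF; exact: sub.
have H2 s z : s \in `]u, v[ -> z \in `[0, 1] -> derivable (F ^~ z) s 1.
  by move=> sI zI; have [] := dF s z sI zI.
have C0 : 0 <= C.
  by rewrite (le_trans _ (CF t 0 (sub _ tI) _))// in_itv/= lexx ler01.
have H3 : (@lebesgue_measure R).-integrable `[0, 1] (EFin \o (fun _ : R => C)).
  by apply: C01_integrable; exact: within_cst.
have H4 s z : s \in `]u, v[ -> z \in `[0, 1] -> `|partial1of2 F s z| <= C.
  by move=> sI zI; rewrite p1E//; apply: CF => //; exact: sub.
split; first exact: (@derivable_under_integral R _ _ (@lebesgue_measure R) F _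
  (measurable_itv _) _ _ _ tI H1 H2 _ _ H3 H4).
rewrite -derive1E (@differentiation_under_integral R _ _ (@lebesgue_measure R) F _
  (measurable_itv _) _ _ _ tI H1 H2 _ _ H3 H4)//.
by apply: eq_int01 => z zI; exact: p1E.
Qed.

End parametric.

(** * One-sided derivatives and derivatives at interior points *)

Section derivatives.
Context {R : realType}.

Lemma has_deriv_within_interior (D : set R) (f : R -> R) (z l : R) :
  nbhs z D -> has_deriv_within D f z l -> is_derive z 1 f l.
Proof.
move=> nD fl; apply/is_derive1_caratheodory.
pose k y := if y == z then l else (f y - f z) / (y - z).
exists k; split.
- move=> y; rewrite /k; have [->|yz] := eqVneq y z; first by rewrite !subrr mulr0.
  by rewrite divfK// subr_eq0.
- apply/continuous_withinNx; rewrite {2}/k eqxx.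
  move=> U /fl; rewrite /= !/nbhs/= /within/= => H.
  have H' := @filterI _ (nbhs z) (nbhs_filter z) _ _ nD H.
  apply: (@filterS _ (nbhs z) (nbhs_filter z) _ _ _ H') => y [Dy Hy] yz.
  rewrite /preimage /= /k (negbTE yz).
  exact: Hy.
- by rewrite /k eqxx.
Qed.

Lemma continuous_pos_part : continuous (fun s : R => Num.max s 0).
Proof.
move=> s; apply: (@continuous_max _ _ id (cst 0)); [exact: cvg_id|exact: cvg_cst].
Qed.

(** The kink of the positive part is harmless for a function [g] that vanishes
    to second order at 0: there, if [k] is a Caratheodory slope of [g], then
    [u |-> k (max u 0)] is one for the composite. *)
Lemma is_derive_pos_part (g dg : R -> R) (s : R) :
  (forall u : R, 0 <= u -> is_derive u 1 g (dg u)) -> g 0 = 0 -> dg 0 = 0 ->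
  is_derive s 1 (fun u => g (Num.max u 0)) (dg (Num.max s 0)).
Proof.
move=> gdg g0 dg0; have [s0|s0|->] := ltgtP s 0.
- apply: (@near_eq_is_derive _ _ _ (cst 0)).
    near=> u; rewrite /= max_r ?g0//; apply: ltW; near: u; exact: lt_nbhsl.
  by rewrite dg0; exact: is_derive_cst.
- apply: (@near_eq_is_derive _ _ _ g); last exact: gdg (ltW s0).
  near=> u; rewrite max_l//; apply: ltW; near: u; exact: lt_nbhsr.
- have /is_derive1_caratheodory[k [gk ck k0]] := gdg 0 (lexx _).
  apply/is_derive1_caratheodory; exists (fun u => k (Num.max u 0)); split.
  + move=> u; rewrite maxxx g0 !subr0; have [u0|u0] := leP u 0.
      by rewrite g0 k0 dg0 mul0r.
    by have := gk u; rewrite g0 !subr0.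
  + apply: (@continuous_comp _ _ _ (fun s : R => Num.max s 0) k).
      exact: continuous_pos_part.
    by rewrite maxxx.
  + by rewrite maxxx.
Unshelve. all: by end_near. Qed.

(** Needed up to the end points of [[0, 1]], where only one-sided derivatives
    exist. *)
Lemma has_deriv_within_continuous (D : set R) (f f' : R -> R) :
  (forall z, D z -> has_deriv_within D f z (f' z)) -> {within D, continuous f}.
Proof.
move=> df; apply/subspace_continuousP => z Dz.
have h : (f y - f z) / (y - z) * (y - z) @[y --> within D z^'] --> f' z * (z - z).
  apply: cvgM; first exact: df.
  apply: cvgB; last exact: cvg_cst.
  by apply: (cvg_trans (cvg_within _)); exact: nbhs_dnbhs.
have {}h : f y @[y --> within D z^'] --> f z.
  have h2 : (f y - f z) / (y - z) * (y - z) + f z @[y --> within D z^'] --> f z.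
    rewrite -[X in _ --> X]add0r -(mulr0 (f' z)) -(subrr z).
    by apply: cvgD => //; exact: cvg_cst.
  apply: cvg_trans h2; apply: near_eq_cvg.
  rewrite !near_withinE; near=> y => yz Dy.
  by rewrite /= divfK ?subrK// subr_eq0.
move=> U /[dup] /nbhs_singleton Uz /h.
rewrite /= !nbhs_simpl /= /dnbhs /within /= => H; near=> y => Dy.
have [->//|yz] := eqVneq y z.
by move: yz Dy; near: y.
Unshelve. all: by end_near. Qed.

Lemma Ck2_derivatives (f : R -> R) : Ck_on 2 `[0, 1] f ->
  exists f1 f2 : R -> R,
    [/\ {within `[0, 1], continuous f}, {within `[0, 1], continuous f1} &
        {within `[0, 1], continuous f2}] /\
    forall z : R, z \in `]0, 1[ ->
      [/\ is_derive z 1 f (f1 z), is_derive z 1 f1 (f2 z) &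
          derive1n 2 f z = f2 z].
Proof.
move=> [f1 [ff1 [f2 [f1f2 /= cf2]]]]; exists f1, f2.
have nI (z : R) : z \in `]0, 1[ -> \forall y \near z, y \in `]0, 1[.
  by move=> zI; exact: near_in_itvoo.
have sub (z : R) : z \in `]0, 1[ -> (`[0, 1]%classic : set R) z.
  by rewrite /= !in_itv/=; lra.
have dI (g dg : R -> R) (z : R) : (forall u : R, `[0, 1]%classic u ->
    has_deriv_within `[0, 1] g u (dg u)) -> z \in `]0, 1[ ->
    is_derive z 1 g (dg z).
  move=> gdg zI; apply: (@has_deriv_within_interior `[0, 1]).
    by apply: filterS (nI _ zI); exact: sub.
  by apply: gdg; exact: sub.
split; first by split => //; [exact: has_deriv_within_continuous ff1|
  exact: has_deriv_within_continuous f1f2].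
move=> z zI; split; [exact: dI|exact: dI|].
rewrite /= derive1E.
have E : \near z, f1 z = derive1 f z.
  near=> y; have yI : y \in `]0, 1[ by near: y; exact: nI.
  by rewrite derive1E; have [_ ->] := dI f f1 y ff1 yI.
by have [_ ->] := near_eq_is_derive E (dI f1 f2 z f1f2 zI).
Unshelve. all: by end_near. Qed.

End derivatives.

(** * A twice differentiable substitute for the squared positive part *)

Section softsqation.
Context {R : realType}.
Variable eta : R.
Hypothesis eta0 : 0 < eta.

(** [ratsq] is close to [u ^+ 2] for [u] large compared with [eta], but vanishes
    to third order at 0, so that its composite [softsq] with the positive part is
    of class C^2. [ratsq1] and [ratsq2] are its first two derivatives. *)
Definition ratsq (u : R) := u ^+ 3 / (u + eta).
Definition ratsq1 (u : R) := u ^+ 2 * (2 * u + 3 * eta) / (u + eta) ^+ 2.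
Definition ratsq2 (u : R) :=
  2 * u * (u ^+ 2 + 3 * eta * u + 3 * eta ^+ 2) / (u + eta) ^+ 3.

Definition softsq (s : R) := ratsq (Num.max s 0).
Definition softsq1 (s : R) := ratsq1 (Num.max s 0).
Definition softsq2 (s : R) := ratsq2 (Num.max s 0).

Let posDeta (u : R) : 0 <= u -> u + eta != 0.
Proof. by move=> u0; rewrite gt_eqF// ltr_wpDl. Qed.

Lemma is_derive_softsq (s : R) : is_derive s 1 softsq (softsq1 s).
Proof.
apply: (@is_derive_pos_part _ ratsq ratsq1).
- move=> u /posDeta ue; rewrite /ratsq /ratsq1.
  have d1 : is_derive u 1 (fun v : R => v + eta) 1.
    by apply: is_derive_eq; rewrite addr0.
  have d2 := @is_deriveV R (fun v : R => v + eta) u 1 1 ue d1.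
  have d3 : is_derive u 1 (fun v : R => v ^+ 3) (3 * u ^+ 2).
    by apply: is_derive_eq; rewrite /GRing.scale/=; ring.
  apply: (is_derive_eq (is_deriveM d3 d2)); rewrite /GRing.scale/=; field.
  exact: ue.
- by rewrite /ratsq expr0n/= mul0r.
- by rewrite /ratsq1 expr0n/= !mul0r.
Qed.

Lemma is_derive_softsq1 (s : R) : is_derive s 1 softsq1 (softsq2 s).
Proof.
apply: (@is_derive_pos_part _ ratsq1 ratsq2).
- move=> u /posDeta ue; rewrite /ratsq1 /ratsq2.
  have d1 : is_derive u 1 (fun v : R => (v + eta) ^+ 2) (2 * (u + eta)).
    by apply: is_derive_eq; rewrite /GRing.scale/= addr0; ring.
  have ue2 : (u + eta) ^+ 2 != 0 by rewrite expf_neq0.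
  have d2 := @is_deriveV R (fun v : R => (v + eta) ^+ 2) u _ 1 ue2 d1.
  have d3 : is_derive u 1 (fun v : R => v ^+ 2 * (2 * v + 3 * eta))
      (6 * u ^+ 2 + 6 * u * eta).
    by apply: is_derive_eq; rewrite /GRing.scale/=; ring.
  apply: (is_derive_eq (is_deriveM d3 d2)); rewrite /GRing.scale/=; field.
  exact: ue.
- by rewrite /ratsq1 expr0n/= !mul0r.
- by rewrite /ratsq2 mulr0 !mul0r.
Qed.

Lemma continuous_softsq : continuous softsq.
Proof.
by move=> s; apply/differentiable_continuous/derivable1_diffP;
  have [] := is_derive_softsq s.
Qed.

Lemma continuous_softsq1 : continuous softsq1.
Proof.
by move=> s; apply/differentiable_continuous/derivable1_diffP;
  have [] := is_derive_softsq1 s.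
Qed.

Lemma continuous_softsq2 : continuous softsq2.
Proof.
move=> s; set m := fun s : R => Num.max s 0.
have cm : {for s, continuous m} by exact: continuous_pos_part.
have m0 : m s + eta != 0 by rewrite posDeta// /m le_max lexx orbT.
apply: (@cvgM _ _ _ _ (fun s => 2 * m s * (m s ^+ 2 + 3 * eta * m s + 3 * eta ^+ 2))
   (fun s => ((m s + eta) ^+ 3)^-1)).
  apply: cvgM; first by apply: cvgM => //; exact: cvg_cst.
  apply: cvgD; last exact: cvg_cst.
  apply: cvgD; first exact: cvgM.
  by apply: cvgM => //; exact: cvg_cst.
apply: cvgV; first exact: expf_neq0.
have cD : m s + eta @[s --> s] --> m s + eta by apply: cvgD => //; exact: cvg_cst.
by apply: cvgM => //; apply: cvgM.
Qed.

Lemma softsq1_ge0 (s : R) : 0 <= softsq1 s.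
Proof.
have : 0 <= Num.max s 0 by rewrite le_max lexx orbT.
rewrite /softsq1 /ratsq1; move: (Num.max s 0) => m m0.
rewrite divr_ge0 ?sqr_ge0// mulr_ge0 ?sqr_ge0//.
by have := eta0; lra.
Qed.

Lemma softsq_le0 (s : R) : s <= 0 -> softsq s = 0.
Proof. by move=> s0; rewrite /softsq max_r// /ratsq expr0n/= mul0r. Qed.

Lemma softsq1_le0 (s : R) : s <= 0 -> softsq1 s = 0.
Proof. by move=> s0; rewrite /softsq1 max_r// /ratsq1 expr0n/= !mul0r. Qed.

Lemma softsq_ge0 (s : R) : 0 <= softsq s.
Proof.
have m0 : 0 <= Num.max s 0 by rewrite le_max lexx orbT.
by rewrite /softsq /ratsq divr_ge0 ?exprn_ge0// addr_ge0// ltW.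
Qed.

Lemma softsq_le_sqr (s : R) : softsq s <= s ^+ 2.
Proof.
have [s0|s0] := leP s 0; first by rewrite softsq_le0// sqr_ge0.
rewrite /softsq /ratsq max_l; last exact: ltW.
by rewrite ler_pdivrMr ?addr_gt0// mulrDr exprSr lerDl mulr_ge0 ?sqr_ge0// ltW.
Qed.

Lemma pos_part_sqr_le_softsq (s : R) :
  Num.max s 0 ^+ 2 <= softsq s + eta * Num.max s 0.
Proof.
have : 0 <= Num.max s 0 by rewrite le_max lexx orbT.
rewrite /softsq /ratsq; move: (Num.max s 0) => m m0.
have e0 := eta0; have me : 0 < m + eta by lra.
rewrite -(ler_pM2r me) mulrDl divfK ?gt_eqF//.
by have := mulr_ge0 m0 (sqr_ge0 eta); nra.
Qed.

Lemma softsq1_mul_le (s : R) : softsq1 s * s <= 3 * softsq s.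
Proof.
have [s0|s0] := leP s 0; first by rewrite softsq_le0// softsq1_le0// mul0r mulr0.
rewrite /softsq1 /softsq /ratsq1 /ratsq max_l; last exact: ltW.
have e0 := eta0; have se : 0 < s + eta by lra.
have -> : 3 * (s ^+ 3 / (s + eta)) =
  s ^+ 2 * (2 * s + 3 * eta) / (s + eta) ^+ 2 * s + s ^+ 4 / (s + eta) ^+ 2.
  by field; lra.
by rewrite lerDl divr_ge0// exprn_ge0// ltW.
Qed.

(** For the squared positive part this is an equality; it is what allows
    [softsq] to replace it in the Poincare inequality. The difference of the two
    sides is three times a square. *)
Lemma softsq1_sqr_le (s : R) : softsq1 s ^+ 2 <= 2 * softsq s * softsq2 s.
Proof.
rewrite /softsq1 /softsq /softsq2 /ratsq1 /ratsq /ratsq2.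
have : 0 <= Num.max s 0 by rewrite le_max lexx orbT.
move: (Num.max s 0) => m m0.
have e0 := eta0; have se : 0 < m + eta by lra.
rewrite -subr_ge0.
have -> : 2 * (m ^+ 3 / (m + eta)) *
    (2 * m * (m ^+ 2 + 3 * eta * m + 3 * eta ^+ 2) / (m + eta) ^+ 3)
   - (m ^+ 2 * (2 * m + 3 * eta) / (m + eta) ^+ 2) ^+ 2 =
   3 * (m ^+ 2 * eta / (m + eta) ^+ 2) ^+ 2.
  by field; lra.
by rewrite mulr_ge0// sqr_ge0.
Qed.

Lemma softsq2_ge0 (s : R) : 0 <= softsq2 s.
Proof.
rewrite /softsq2 /ratsq2.
have : 0 <= Num.max s 0 by rewrite le_max lexx orbT.
move: (Num.max s 0) => m m0.
have e0 := eta0; have me : 0 < m + eta by lra.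
by rewrite divr_ge0 ?exprn_ge0 ?mulr_ge0//; nra.
Qed.

End softsqation.

(** * Decay of the energy of subsolutions *)

Section energy.
Context {R : realType}.
Variable eta : R.
Hypothesis eta0 : 0 < eta.
Local Notation phi := (softsq eta).
Local Notation phi1 := (softsq1 eta).
Local Notation phi2 := (softsq2 eta).

(** The discriminant [th^2 d^2 - P Q / 2] of the quadratic in [w] is nonpositive. *)
Lemma quadratic_ge0 (P Q d th w : R) : 0 <= P -> 0 <= Q ->
  d ^+ 2 <= 2 * Q * P -> th ^+ 2 <= 1 / 4 ->
  0 <= P * w ^+ 2 + Q / 8 - th * (d * w).
Proof.
move=> P0 Q0 dPQ th4; have [P_eq0|Pn0] := eqVneq P 0.
  have -> : d = 0.
    by apply/eqP; rewrite -sqrf_eq0 eq_le sqr_ge0 andbT (le_trans dPQ)// P_eq0 mulr0.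
  by rewrite P_eq0 !mul0r mulr0; lra.
have Pgt0 : 0 < P by rewrite lt0r Pn0.
rewrite -(pmulr_rge0 _ Pgt0).
have h1 := sqr_ge0 (P * w - th * d / 2).
have h2 : d ^+ 2 * th ^+ 2 <= d ^+ 2 * (1 / 4) by rewrite ler_wpM2l// sqr_ge0.
nra.
Qed.

(** Integration by parts and a Poincare inequality in one step: the integrand
    is at most the derivative of [phi1 f * f1 - (1/2 - z) * phi f], a function
    that vanishes at both ends because [f] is nonpositive there. The second summand produces
    the term [phi f]; the cross term that comes with it is absorbed by
    [phi2 f * f1 ^+ 2] thanks to [quadratic_ge0]. The constant is [1 - 1/8]. *)
Lemma int01_softsq_poincare (f f1 f2 : R -> R) :
  C01 f -> C01 f1 -> C01 f2 ->
  (forall z : R, z \in `]0, 1[ -> is_derive z 1 f (f1 z)) ->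
  (forall z : R, z \in `]0, 1[ -> is_derive z 1 f1 (f2 z)) ->
  f 0 <= 0 -> f 1 <= 0 ->
  int01 (fun z => phi1 (f z) * f2 z + 7 / 8 * phi (f z)) <= 0.
Proof.
move=> cf cf1 cf2 df df1 f00 f10.
pose G z := phi1 (f z) * f1 z - (1 / 2 - z) * phi (f z).
pose G' z := phi2 (f z) * f1 z ^+ 2 + phi1 (f z) * f2 z + phi (f z)
  - (1 / 2 - z) * (phi1 (f z) * f1 z).
have cphi : C01 (fun z => phi (f z)).
  by apply: within_post => //; exact: continuous_softsq.
have cphi1 : C01 (fun z => phi1 (f z)).
  by apply: within_post => //; exact: continuous_softsq1.
have cphi2 : C01 (fun z => phi2 (f z)).
  by apply: within_post => //; exact: continuous_softsq2.
have cth : C01 (fun z : R => 1 / 2 - z).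
  apply: within_sub; first exact: within_cst.
  by apply: continuous_subspaceT => z; exact: cvg_id.
have cG : C01 G by apply: within_sub; exact: within_mul.
have cG' : C01 G'.
  apply: within_sub; last by apply: within_mul => //; exact: within_mul.
  apply: within_add => //; apply: within_add; last exact: within_mul.
  by apply: within_mul => //; exact: within_mul.
have dG (z : R) : z \in `]0, 1[ -> is_derive z 1 G (G' z).
  move=> zI; have d0 := df z zI; have d1 := df1 z zI.
  have dp : is_derive z 1 (fun z => phi (f z)) (phi1 (f z) * f1 z).
    exact: (is_derive1_comp (is_derive_softsq eta0 (f z)) d0).
  have dp1 : is_derive z 1 (fun z => phi1 (f z)) (phi2 (f z) * f1 z).
    exact: (is_derive1_comp (is_derive_softsq1 eta0 (f z)) d0).
  have dth : is_derive z 1 (fun z : R => 1 / 2 - z) (- 1).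
    by apply: is_derive_eq; rewrite add0r mul1r.
  have e1 : is_derive z 1 (fun z => phi1 (f z) * f1 z) _ := is_deriveM dp1 d1.
  have e2 : is_derive z 1 (fun z => (1 / 2 - z) * phi (f z)) _ :=
    is_deriveM dth dp.
  have e3 : is_derive z 1 G _ := is_deriveB e1 e2.
  apply: (is_derive_eq e3); rewrite /G' /GRing.scale/=.
  have E (p p1 p2 w1 w2 th : R) : p1 * w2 + w1 * (p2 * w1) -
      (th * (p1 * w1) + p * - 1) =
      p2 * w1 ^+ 2 + p1 * w2 + p - th * (p1 * w1) by ring.
  exact: E.
have GE : int01 G' = 0.
  by rewrite (int01_FTC cG cG' dG) /G !(softsq_le0, softsq1_le0)// !mul0r !mulr0 !subrr.
rewrite -GE; apply: int01_le => //.
  apply: within_add; first exact: within_mul.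
  by apply: within_mul => //; exact: within_cst.
move=> z zI; rewrite /G'.
have th : (1 / 2 - z) ^+ 2 <= 1 / 4 by move: zI; rewrite in_itv/=; nra.
have := quadratic_ge0 (f1 z) (softsq2_ge0 eta0 (f z)) (softsq_ge0 eta0 (f z))
  (softsq1_sqr_le eta0 (f z)) th.
lra.
Qed.

(** Testing [yt <= a y'' + delta y] with [phi1 y >= 0] gives
    [E' <= a int (phi1 y * y'') + 3 delta E] for the energy [E = int (phi y)],
    and the Poincare inequality makes this nonpositive as soon as
    [3 delta <= 7/8 a]. The derivative [yt] need not be bounded as [t] tends to
    0: continuity of [E] at 0 suffices. *)
Lemma softsq_energy_le (a delta T : R) (y yt : R -> R -> R) :
  0 < T -> 0 <= a -> 24 * delta <= 7 * a -> 0 <= delta ->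
  {within `[0, T] `*` `[0, 1], continuous (fun p : R * R => y p.1 p.2)} ->
  {within `]0, T] `*` `[0, 1], continuous (fun p : R * R => yt p.1 p.2)} ->
  (forall t z : R, t \in `]0, T[ -> z \in `[0, 1] ->
     is_derive t 1 (y ^~ z) (yt t z)) ->
  (forall t : R, t \in `]0, T[ -> y t 0 <= 0 /\ y t 1 <= 0) ->
  (forall t : R, t \in `]0, T[ -> exists f1 f2 : R -> R,
     [/\ C01 f1, C01 f2 & forall z : R, z \in `]0, 1[ ->
       [/\ is_derive z 1 (y t) (f1 z), is_derive z 1 f1 (f2 z) &
           yt t z <= a * f2 z + delta * y t z]]) ->
  int01 (fun z => phi (y T z)) <= int01 (fun z => phi (y 0 z)).
Proof.
move=> T0 a0 da d0 cy cyt dy bd pde.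
have cys (t : R) : t \in `[0, T] -> C01 (y t).
  by move=> tI; exact: within_slice tI cy.
have cyts (t : R) : t \in `]0, T[ -> C01 (yt t).
  move=> tI; apply: (within_slice (A := `]0, T])) cyt => /=.
  by move: tI; rewrite !in_itv/=; lra.
have cphi := @continuous_softsq R eta eta0.
have cphi1 := @continuous_softsq1 R eta eta0.
have cE : {within `[0, T], continuous (fun t => int01 (fun z => phi (y t z)))}.
  apply: (@int01_continuous R (fun t z => phi (y t z))); first exact: ltW.
  exact: within_post.
have oc (t : R) : t \in `]0, T[ -> t \in `[0, T] by rewrite !in_itv/=; lra.
have dE (t : R) : t \in `]0, T[ -> is_derive t 1 (fun t => int01 (fun z => phi (y t z)))
    (int01 (fun z => phi1 (y t z) * yt t z)).
  move=> tI; have [t0 tT] : 0 < t /\ t < T by move: tI; rewrite in_itv/= => /andP.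
  have tI' : t \in `](t / 2), ((t + T) / 2)[ by rewrite in_itv/=; lra.
  have H1 s : s \in `[(t / 2), ((t + T) / 2)] -> C01 (fun z => phi (y s z)).
    move=> sI; apply: within_post => //; apply: cys.
    by move: sI; rewrite !in_itv/=; lra.
  have H2 : {within `[(t / 2), ((t + T) / 2)] `*` `[0, 1],
      continuous (fun p : R * R => phi1 (y p.1 p.2) * yt p.1 p.2)}.
    apply: within_mul.
      apply: within_post => //; apply: continuous_subspaceW cy => -[s z] [/= sI zI].
      by split => //=; move: sI; rewrite !in_itv/=; lra.
    apply: continuous_subspaceW cyt => -[s z] [/= sI zI].
    by split => //=; move: sI; rewrite !in_itv/=; lra.
  have H3 (s z : R) : s \in `](t / 2), ((t + T) / 2)[ -> z \in `[0, 1] ->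
      is_derive s 1 (fun s => phi (y s z)) (phi1 (y s z) * yt s z).
    move=> sI zI; apply: (is_derive1_comp (is_derive_softsq eta0 (y s z))).
    by apply: dy => //; move: sI; rewrite !in_itv/=; lra.
  exact: (@int01_is_derive R (fun t z => phi (y t z))
    (fun t z => phi1 (y t z) * yt t z) _ _ _ tI' H1 H2 H3).
have dE_le0 (t : R) : t \in `]0, T[ -> int01 (fun z => phi1 (y t z) * yt t z) <= 0.
  move=> tI; have [f1 [f2 [cf1 cf2 pdet]]] := pde t tI.
  have [y0 y1] := bd t tI; have cyt' := cys t (oc t tI).
  have P := int01_softsq_poincare cyt' cf1 cf2
    (fun z zI => let: And3 h _ _ := pdet z zI in h)
    (fun z zI => let: And3 _ h _ := pdet z zI in h) y0 y1.
  set h := (fun z => _ + _) in P.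
  have ch : C01 h.
    apply: within_add; first by apply: within_mul => //; exact: within_post.
    by apply: within_mul; [exact: within_cst|exact: within_post].
  have ch' : C01 (fun z => a * h z) by apply: within_mul => //; exact: within_cst.
  apply: (@le_trans _ _ (int01 (fun z => a * h z))); last first.
    by rewrite int01Z// mulr_ge0_le0.
  apply: int01_le => //.
    by apply: within_mul; [exact: within_post|exact: cyts].
  (* At the end points the differential inequality is not available, but
     there [phi1 (y t z)] vanishes. *)
  move=> z zI; have [->|z0] := eqVneq z 0.
    by rewrite /h softsq1_le0// softsq_le0// !mul0r mulr0 addr0 mulr0.
  have [->|z1] := eqVneq z 1.
    by rewrite /h softsq1_le0// softsq_le0// !mul0r mulr0 addr0 mulr0.
  have zI' : z \in `]0, 1[.
    by move: zI; rewrite !in_itv/= !le_eqVlt eq_sym (negbTE z0) (negbTE z1).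
  have [_ _ le] := pdet z zI'; rewrite /h.
  have p1 := softsq1_ge0 eta0 (y t z); have p2 := softsq1_mul_le eta0 (y t z).
  have p3 := softsq_ge0 eta0 (y t z).
  apply: (le_trans (ler_wpM2l p1 le)).
  have : delta * (phi1 (y t z) * y t z) <= delta * (3 * phi (y t z)).
    exact: ler_wpM2l.
  have : 24 * delta * phi (y t z) <= 7 * a * phi (y t z) by exact: ler_wpM2r.
  lra.
apply: (@ler0_derive1_le_cc _ (fun t => int01 (fun z => phi (y t z))) 0 T).
- by move=> t tI; have [] := dE t tI.
- by move=> t tI; rewrite derive1E; have [_ ->] := dE t tI; exact: dE_le0.
- exact: cE.
- by rewrite in_itv/= lexx ltW.
- by rewrite in_itv/= lexx ltW.
- exact: ltW.
Qed.

End energy.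

(** * From the energies of the excesses to a norm estimate *)

Section combine.
Context {R : realType}.

(** [|u|] is at most [w] plus its excess over [w], and only one of the two
    positive parts can be nonzero; the rest is Young's inequality. *)
Lemma sqr_le_excess (u w r : R) : 0 <= w -> 0 < r ->
  u ^+ 2 <= (1 + r) * w ^+ 2 +
    (1 + r^-1) * (Num.max (u - w) 0 ^+ 2 + Num.max (- u - w) 0 ^+ 2).
Proof.
move=> w0 r0.
have young (m : R) : (w + m) ^+ 2 <= (1 + r) * w ^+ 2 + (1 + r^-1) * m ^+ 2.
  rewrite -subr_ge0; have -> : (1 + r) * w ^+ 2 + (1 + r^-1) * m ^+ 2 -
    (w + m) ^+ 2 = r^-1 * (r * w - m) ^+ 2 by field; rewrite gt_eqF.
  by rewrite mulr_ge0 ?sqr_ge0// invr_ge0 ltW.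
have r1 : 0 <= 1 + r^-1 by rewrite addr_ge0// invr_ge0 ltW.
have up : u - w <= Num.max (u - w) 0 by rewrite le_max lexx.
have un : - u - w <= Num.max (- u - w) 0 by rewrite le_max lexx.
have p0 : 0 <= Num.max (u - w) 0 by rewrite le_max lexx orbT.
have n0 : 0 <= Num.max (- u - w) 0 by rewrite le_max lexx orbT.
move: (Num.max (u - w) 0) (Num.max (- u - w) 0) up un p0 n0 => p n up un p0 n0.
have pp := mulr_ge0 r1 (sqr_ge0 p); have nn := mulr_ge0 r1 (sqr_ge0 n).
rewrite mulrDr; have [u0|u0] := leP 0 u.
  have : u ^+ 2 <= (w + p) ^+ 2 by rewrite ler_sqr ?nnegrE//; lra.
  by have := young p; lra.
have : u ^+ 2 <= (w + n) ^+ 2 by rewrite -sqrrN ler_sqr ?nnegrE//; lra.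
by have := young n; lra.
Qed.

Lemma softsq_excess_le_sqr (eta v w : R) : 0 < eta -> 0 <= w ->
  softsq eta (v - w) + softsq eta (- v - w) <= v ^+ 2.
Proof.
move=> eta0 w0.
have pos (s : R) : 0 <= s ->
    softsq eta (s - w) + softsq eta (- s - w) <= s ^+ 2.
  move=> s0; rewrite (@softsq_le0 _ _ (- s - w)) ?addr0; last lra.
  have [sw|sw] := leP (s - w) 0; first by rewrite softsq_le0// sqr_ge0.
  by rewrite (le_trans (softsq_le_sqr eta0 _))// ler_sqr ?nnegrE; lra.
have [v0|v0] := leP 0 v; first exact: pos.
by have := pos (- v); rewrite opprK sqrrN addrC; apply; lra.
Qed.

(** The limit [eta -> 0]: the regularized energy misses the squared excess by at
    most [eta] times the excess, hence by at most [eta * |u|]. *)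
Lemma int01_sqr_le_excess (u v w : R -> R) (r : R) : 0 < r ->
  C01 u -> C01 v -> C01 w -> (forall z, z \in `[0, 1] -> 0 <= w z) ->
  (forall eta, 0 < eta ->
    int01 (fun z => softsq eta (u z - w z)) <=
      int01 (fun z => softsq eta (v z - w z)) /\
    int01 (fun z => softsq eta (- u z - w z)) <=
      int01 (fun z => softsq eta (- v z - w z))) ->
  int01 (fun z => u z ^+ 2) <=
    (1 + r) * int01 (fun z => w z ^+ 2) + (1 + r^-1) * int01 (fun z => v z ^+ 2).
Proof.
move=> r0 cu cv cw w0 H.
have cN (f : R -> R) : C01 f -> C01 (fun z => - f z).
  by move=> cf x; apply: cvgN; exact: cf.
have csq (f : R -> R) : C01 f -> C01 (fun z => f z ^+ 2) by move=> cf; exact: within_mul.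
have cZ c (f : R -> R) : C01 f -> C01 (fun z => c * f z).
  by move=> cf; apply: within_mul => //; exact: within_cst.
have cabs : C01 (fun z => `|u z|).
  by apply: (within_post (@norm_continuous R R)).
have r1 : 0 < 1 + r^-1 by rewrite addr_gt0// invr_gt0.
set K := int01 (fun z => `|u z|).
have K0 : 0 <= K by apply: int01_ge0.
apply/ler_addgt0Pr => e e0.
pose eta := e / ((1 + r^-1) * (2 * K + 1)).
have D0 : 0 < (1 + r^-1) * (2 * K + 1) by rewrite mulr_gt0//; lra.
have eta0 : 0 < eta by rewrite divr_gt0.
have etaE : (1 + r^-1) * (2 * eta * K) <= e.
  have : eta * ((1 + r^-1) * (2 * K + 1)) = e by rewrite divfK// gt_eqF.
  have : 0 <= eta * (1 + r^-1) by rewrite mulr_ge0// ltW.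
  by lra.
have cphi (f : R -> R) : C01 f -> C01 (fun z => softsq eta (f z)).
  by move=> cf; apply: within_post => //; exact: continuous_softsq.
have [H1 H2] := H eta eta0.
have c1 : C01 (fun z => softsq eta (u z - w z)) by apply: cphi; exact: within_sub.
have c2 : C01 (fun z => softsq eta (- u z - w z)).
  by apply: cphi; apply: within_sub => //; exact: cN.
have c3 : C01 (fun z => softsq eta (v z - w z)) by apply: cphi; exact: within_sub.
have c4 : C01 (fun z => softsq eta (- v z - w z)).
  by apply: cphi; apply: within_sub => //; exact: cN.
have Hv : int01 (fun z => softsq eta (v z - w z)) +
    int01 (fun z => softsq eta (- v z - w z)) <= int01 (fun z => v z ^+ 2).
  rewrite -int01D//; apply: int01_le => [| |z zI]; [exact: within_add|exact: csq|].
  by apply: softsq_excess_le_sqr => //; exact: w0.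
pose S z := softsq eta (u z - w z) + softsq eta (- u z - w z) + 2 * eta * `|u z|.
have cS : C01 S by apply: within_add; [exact: within_add|exact: cZ].
have SE : int01 S = int01 (fun z => softsq eta (u z - w z)) +
      int01 (fun z => softsq eta (- u z - w z)) + 2 * eta * K.
  rewrite /K -(int01Z (2 * eta) cabs) -(int01D c1 c2) -int01D//.
    exact: within_add.
  exact: cZ.
have Hu : int01 (fun z => u z ^+ 2) <= (1 + r) * int01 (fun z => w z ^+ 2) +
    (1 + r^-1) * int01 S.
  rewrite -(int01Z (1 + r) (csq _ cw)) -(int01Z _ cS).
  rewrite -int01D; [|by apply: cZ; exact: csq|exact: cZ].
  apply: int01_le => [| |z zI]; [exact: csq| |].
    by apply: within_add; apply: cZ => //; exact: csq.
  apply: (le_trans (sqr_le_excess (u z) (w0 z zI) r0)).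
  rewrite lerD2l ler_wpM2l//; first exact: ltW.
  have h1 := pos_part_sqr_le_softsq eta0 (u z - w z).
  have h2 := pos_part_sqr_le_softsq eta0 (- u z - w z).
  have wz := w0 z zI.
  have p1 : Num.max (u z - w z) 0 <= `|u z|.
    by rewrite ge_max normr_ge0 andbT; have := ler_norm (u z); lra.
  have p2 : Num.max (- u z - w z) 0 <= `|u z|.
    by rewrite ge_max normr_ge0 andbT; have := ler_norm (- u z); rewrite normrN; lra.
  have q1 := ler_wpM2l (ltW eta0) p1; have q2 := ler_wpM2l (ltW eta0) p2.
  rewrite /S; lra.
apply: (le_trans Hu); rewrite SE.
have : (1 + r^-1) * (int01 (fun z => softsq eta (u z - w z)) +
      int01 (fun z => softsq eta (- u z - w z))) <=
   (1 + r^-1) * int01 (fun z => v z ^+ 2).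
  by rewrite ler_pM2l//; lra.
rewrite (mulrDr (1 + r^-1) _ (2 * eta * K)); lra.
Qed.

End combine.

(** * The barrier *)

Section barrier.
Context {R : realType}.
Variables A B k : R.
Hypotheses (A0 : 0 <= A) (B0 : 0 <= B) (AB : A + B <= 2) (k0 : 0 <= k) (k1 : k <= 1).

Definition barrier (z : R) := A * (1 - z) + B * z + k * (z * (1 - z)).

Definition barrier1 (z : R) := B - A + k * (1 - 2 * z).

Lemma is_derive_barrier (z : R) : is_derive z 1 barrier (barrier1 z).
Proof.
rewrite /barrier /barrier1; apply: is_derive_eq; rewrite /GRing.scale/=.
ring.
Qed.

Lemma is_derive_barrier1 (z : R) : is_derive z 1 barrier1 (- 2 * k).
Proof.
rewrite /barrier1; apply: is_derive_eq; rewrite /GRing.scale/=.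
ring.
Qed.

Lemma continuous_barrier : continuous barrier.
Proof.
by move=> s; apply/differentiable_continuous/derivable1_diffP;
  have [] := is_derive_barrier s.
Qed.

Lemma continuous_barrier1 : continuous barrier1.
Proof.
by move=> s; apply/differentiable_continuous/derivable1_diffP;
  have [] := is_derive_barrier1 s.
Qed.

Lemma barrier_ge0 (z : R) : z \in `[0, 1] -> 0 <= barrier z.
Proof.
rewrite in_itv/= => /andP[z0 z1].
have z1' : 0 <= 1 - z by lra.
by rewrite /barrier !addr_ge0// !mulr_ge0.
Qed.

Lemma barrier_le3 (z : R) : z \in `[0, 1] -> barrier z <= 3.
Proof.
rewrite in_itv/= => /andP[z0 z1]; rewrite /barrier.
have h1 : 0 <= A * z by exact: mulr_ge0.
have h2 : 0 <= B * (1 - z) by apply: mulr_ge0 => //; lra.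
have z1' : 0 <= 1 - z by lra.
have h3 : 0 <= (1 - k) * (z * (1 - z)) by rewrite !mulr_ge0// subr_ge0.
have h4 := sqr_ge0 (1 - z).
have ab := AB; lra.
Qed.

(** The affine part has squared norm [(A^2 + A B + B^2) / 3], and the concave
    correction changes the square by at most [5 k] pointwise. *)
Lemma int01_barrier_sqr :
  int01 (fun z => barrier z ^+ 2) <= (A + B) ^+ 2 / 3 + 5 * k.
Proof.
pose L (z : R) := A * (1 - z) + B * z.
pose P (z : R) := A ^+ 2 * (z - z ^+ 2 + z ^+ 3 / 3)
  + 2 * (A * B) * (z ^+ 2 / 2 - z ^+ 3 / 3) + B ^+ 2 * (z ^+ 3 / 3) + 5 * k * z.
have dP (z : R) : is_derive z 1 P (L z ^+ 2 + 5 * k).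
  rewrite /P; apply: is_derive_eq; rewrite /GRing.scale/= /L.
  by field.
have cP : C01 P.
  apply: continuous_subspaceT => s.
  by apply/differentiable_continuous/derivable1_diffP; have [] := dP s.
have cL : C01 (fun z => L z ^+ 2 + 5 * k).
  apply: within_add; last exact: within_cst.
  have cL : C01 L.
    apply: continuous_subspaceT => z.
    apply: cvgD; apply: cvgM; try exact: cvg_cst; last exact: cvg_id.
    by apply: cvgB; [exact: cvg_cst|exact: cvg_id].
  exact: within_mul.
have := int01_FTC cP cL (fun z _ => dP z).
have -> : P 1 - P 0 = (A ^+ 2 + A * B + B ^+ 2) / 3 + 5 * k by rewrite /P; field.
move=> E.
apply: (@le_trans _ _ ((A ^+ 2 + A * B + B ^+ 2) / 3 + 5 * k)); last first.
  by have := mulr_ge0 A0 B0; lra.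
rewrite -E; apply: int01_le => // [|z zI].
  have cb : C01 barrier by apply: continuous_subspaceT; exact: continuous_barrier.
  exact: within_mul.
move: zI; rewrite in_itv/= => /andP[z0 z1].
have h1 : 0 <= A * z by exact: mulr_ge0.
have h2 : 0 <= B * (1 - z) by apply: mulr_ge0 => //; lra.
have ab := AB; have L2 : L z <= 2 by rewrite /L; lra.
have z1' : 0 <= 1 - z by lra.
have L0 : 0 <= L z by rewrite /L addr_ge0// mulr_ge0.
have q0 : 0 <= z * (1 - z) by rewrite mulr_ge0.
have q1 : z * (1 - z) <= 1 by have := sqr_ge0 (1 - z); nra.
rewrite /barrier -/(L z); move: (L z) (z * (1 - z)) L2 L0 q0 q1 => l q L2 L0 q0 q1.
have kq : k * q <= k by rewrite -[leRHS]mulr1 ler_wpM2l.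
have kq0 : 0 <= k * q by exact: mulr_ge0.
have : l * (k * q) <= 2 * k by apply: ler_pM.
have : (k * q) * (k * q) <= k * 1 by apply: ler_pM => //; exact: le_trans kq k1.
lra.
Qed.

End barrier.

(** * Comparison of a solution with the barrier *)

Section comparison.
Context {R : realType}.

Lemma solution_slice (a : R) g0 g1 x0 x (t : R) :
  is_solution a g0 g1 x0 x -> 0 <= t -> C01 (x t).
Proof.
move=> [cx _] t0; apply: (within_slice (A := `[0, +oo[)) cx.
by rewrite /= in_itv/= t0.
Qed.

Lemma weighted_boundary_le (g x : R -> R) (e sg P c : R) : C01 g -> C01 x ->
  `|sg| = 1 -> 0 <= e -> e * l2norm x <= P -> c = int01 (fun z => g z * x z) ->
  sg * e * c <= P * l2norm g.
Proof.
move=> cg cx sg1 e0 eP ->; apply: (le_trans (ler_norm _)).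
rewrite !normrM sg1 mul1r (ger0_norm e0).
apply: (le_trans (ler_wpM2l e0 (norm_int01_le cg cx))).
by rewrite mulrCA mulrC ler_wpM2r// l2norm_ge0.
Qed.

Lemma continuous_weight (delta : R) : continuous (fun t : R => expR (delta * t)).
Proof.
move=> t; apply: (@continuous_comp _ _ _ (fun t : R => delta * t) expR).
  by apply: cvgM; [exact: cvg_cst|exact: cvg_id].
exact: continuous_expR.
Qed.

Lemma is_derive_weight (delta t : R) :
  is_derive t 1 (fun t : R => expR (delta * t)) (delta * expR (delta * t)).
Proof.
have d : is_derive t 1 (fun t : R => delta * t) delta.
  by apply: is_derive_eq; rewrite /GRing.scale/= mulr1.
apply: (is_derive_eq (is_derive1_comp (is_derive_expR (delta * t)) d)).
by rewrite mulrC.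
Qed.

(** The function [y] is a subsolution for the operator [a d^2/dz^2 + delta]: as
    [psi'' = - 2 k] and [psi <= 3], the choice [delta = a k / 4] gives
    [delta psi + a psi'' <= 0]. On the boundary the nonlocal conditions and
    Cauchy-Schwarz give [y <= 0], [P] being a bound for the weighted norm. The
    sign [sg] serves to bound the solution from above and from below. *)
Lemma solution_comparison (a k T P sg eta : R) (g0 g1 x0 : R -> R)
    (x : R -> R -> R) :
  let delta := a * k / 4 in
  let psi := barrier (l2norm g0) (l2norm g1) k in
  let y t z := sg * expR (delta * t) * x t z - P * psi z in
  0 < a -> C01 g0 -> C01 g1 -> l2norm g0 + l2norm g1 <= 2 -> 0 <= k -> k <= 1 ->
  is_solution a g0 g1 x0 x -> 0 < T -> `|sg| = 1 -> 0 < eta ->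
  (forall t, t \in `[0, T] -> expR (delta * t) * l2norm (x t) <= P) ->
  int01 (fun z => softsq eta (y T z)) <= int01 (fun z => softsq eta (y 0 z)).
Proof.
move=> delta psi y a0 cg0 cg1 AB k0 k1 sol T0 sg1 eta0 HP.
have := sol => -[cx [[xt [xz [dx cxt _]]] [C2 [pde [bc0 [bc1 _]]]]]].
have A0 := l2norm_ge0 g0; have B0 := l2norm_ge0 g1.
have P0 : 0 <= P.
  have := HP 0; rewrite mulr0 expR0 mul1r => h; apply: (le_trans (l2norm_ge0 (x 0))).
  by apply: h; rewrite in_itv/= lexx ltW.
have ak0 : 0 <= a * k by rewrite mulr_ge0// ltW.
have ak : a * k <= a by rewrite ger_pMr.
have cpsi : continuous psi by exact: continuous_barrier.
pose e (t : R) := expR (delta * t).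
pose yt t z := sg * (e t * xt t z + delta * e t * x t z).
have ce : continuous e by exact: continuous_weight.
have cfst (D : set (R * R)) : {within D, continuous (fun p : R * R => p.1)}.
  by apply: continuous_subspaceT => p; exact: cvg_fst.
have csnd (D : set (R * R)) : {within D, continuous (fun p : R * R => p.2)}.
  by apply: continuous_subspaceT => p; exact: cvg_snd.
have cx' : {within `[0, T] `*` `[0, 1], continuous (fun p : R * R => x p.1 p.2)}.
  apply: continuous_subspaceW cx => -[t z] [/= tI zI]; split => //=.
  by move: tI; rewrite !in_itv/=; lra.
have cx'' : {within `]0, T] `*` `[0, 1], continuous (fun p : R * R => x p.1 p.2)}.
  apply: continuous_subspaceW cx' => -[t z] [/= tI zI]; split => //=.
  by move: tI; rewrite !in_itv/=; lra.
have cxt' : {within `]0, T] `*` `[0, 1], continuous (fun p : R * R => xt p.1 p.2)}.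
  apply: continuous_subspaceW cxt => -[t z] [/= tI zI]; split => //=.
  by move: tI; rewrite !in_itv/=; lra.
have cy : {within `[0, T] `*` `[0, 1], continuous (fun p : R * R => y p.1 p.2)}.
  apply: within_sub.
    apply: within_mul cx'; apply: within_mul; first exact: within_cst.
    exact: (within_post ce (cfst _)).
  apply: within_mul; first exact: within_cst.
  exact: (within_post cpsi (csnd _)).
have cyt : {within `]0, T] `*` `[0, 1], continuous (fun p : R * R => yt p.1 p.2)}.
  have c1 := within_post ce (cfst (`]0, T] `*` `[0, 1])).
  apply: within_mul; first exact: within_cst.
  apply: within_add; first exact: within_mul.
  by apply: within_mul cx''; apply: within_mul => //; exact: within_cst.
have tI2 (t : R) : t \in `]0, T[ -> 0 < t /\ t \in `[0, T].
  by rewrite !in_itv/=; lra.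
have dy (t z : R) : t \in `]0, T[ -> z \in `[0, 1] ->
    is_derive t 1 (y ^~ z) (yt t z).
  move=> tI zI; have [t0 _] := tI2 _ tI.
  have [d1 _] := dx t z t0 zI.
  have d2 := is_derive_weight delta t.
  have d3 : is_derive t 1 (fun t => expR (delta * t) * x t z) _ := is_deriveM d2 d1.
  have d4 : is_derive t 1 (fun t => sg * (expR (delta * t) * x t z)) _ :=
    is_deriveZ sg d3.
  have d5 : is_derive t 1 (fun t => sg * (expR (delta * t) * x t z) - P * psi z) _
    := is_deriveB d4 (is_derive_cst (P * psi z) t 1).
  have -> : y ^~ z = (fun t => sg * (expR (delta * t) * x t z) - P * psi z).
    by apply/funext => s; rewrite /y mulrA.
  apply: (is_derive_eq d5); rewrite /yt /GRing.scale/= subr0 -/(e t).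
  by rewrite (mulrC (x t z)).
have bd (t : R) : t \in `]0, T[ -> y t 0 <= 0 /\ y t 1 <= 0.
  move=> tI; have [t0 tI'] := tI2 _ tI; have t0' := ltW t0.
  have cxs := solution_slice sol t0'.
  have h0 := weighted_boundary_le cg0 cxs sg1 (expR_ge0 _) (HP t tI') (bc0 t t0').
  have h1 := weighted_boundary_le cg1 cxs sg1 (expR_ge0 _) (HP t tI') (bc1 t t0').
  have p0 : psi 0 = l2norm g0 by rewrite /psi /barrier; ring.
  have p1 : psi 1 = l2norm g1 by rewrite /psi /barrier; ring.
  by rewrite /y p0 p1 !subr_le0.
have pde' (t : R) : t \in `]0, T[ -> exists f1 f2 : R -> R,
     [/\ C01 f1, C01 f2 & forall z : R, z \in `]0, 1[ ->
       [/\ is_derive z 1 (y t) (f1 z), is_derive z 1 f1 (f2 z) &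
           yt t z <= a * f2 z + delta * y t z]].
  move=> tI; have [t0 _] := tI2 _ tI.
  have [x1 [x2 [[_ cx1 cx2] dx12]]] := Ck2_derivatives (C2 t (ltW t0)).
  pose s := sg * e t.
  exists (fun z => s * x1 z - P * barrier1 (l2norm g0) (l2norm g1) k z).
  exists (fun z => s * x2 z - P * (- 2 * k)); split.
  - apply: within_sub; apply: within_mul => //; try exact: within_cst.
    by apply: continuous_subspaceT; exact: continuous_barrier1.
  - by apply: within_sub; [apply: within_mul => //|]; exact: within_cst.
  move=> z zI; have [d1 d2 x2E] := dx12 z zI; split.
  - have db : is_derive z 1 psi _ := is_derive_barrier _ _ _ z.
    exact: (is_deriveB (is_deriveZ s d1) (is_deriveZ P db)).
  - have db := is_derive_barrier1 (l2norm g0) (l2norm g1) k z.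
    exact: (is_deriveB (is_deriveZ s d2) (is_deriveZ P db)).
  - have zI' : z \in `[0, 1] by move: zI; rewrite !in_itv/=; lra.
    have xtE : xt t z = a * x2 z.
      have [[_ <-] _] := dx t z t0 zI'.
      by rewrite -derive1E pde// x2E.
    rewrite /yt xtE /y -/(e t) -/s.
    have psi3 : psi z <= 3 by exact: barrier_le3.
    have h1 : P * (a * k) * psi z <= P * (a * k) * 3.
      by rewrite ler_wpM2l// mulr_ge0.
    have h2 : 0 <= P * (a * k) by exact: mulr_ge0.
    rewrite /s /delta; move: (e t) (x2 z) (x t z) (psi z) h1 h2 => u v w q h1 h2.
    lra.
have := @softsq_energy_le R eta eta0 a delta T y yt T0 (ltW a0) _ _ cy cyt dy bd pde'.
by apply; rewrite /delta; lra.
Qed.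

End comparison.

(** * Small gain *)

Section small_gain.
Context {R : realType}.

(** At a time [c] where the weighted norm [n] is maximal over the past, [n c] can
    be used as the bound [P] of the comparison, and the estimate closes on [n c]
    itself. *)
Lemma solution_sqr_le (a k r c : R) (g0 g1 x0 : R -> R) (x : R -> R -> R) :
  let delta := a * k / 4 in
  let n t := expR (delta * t) * l2norm (x t) in
  0 < a -> C01 g0 -> C01 g1 -> l2norm g0 + l2norm g1 <= 2 -> 0 <= k -> k <= 1 ->
  is_solution a g0 g1 x0 x -> 0 < r -> 0 < c ->
  (forall t, t \in `[0, c] -> n t <= n c) ->
  n c ^+ 2 <= (1 + r) * ((l2norm g0 + l2norm g1) ^+ 2 / 3 + 5 * k) * n c ^+ 2
              + (1 + r^-1) * l2norm (x 0) ^+ 2.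
Proof.
move=> delta n a0 cg0 cg1 AB k0 k1 sol r0 c0 nmax.
set psi := barrier (l2norm g0) (l2norm g1) k.
have cpsi : C01 psi by apply: continuous_subspaceT; exact: continuous_barrier.
have cxc := solution_slice sol (ltW c0); have cx0 := solution_slice sol (lexx 0).
have n0 : 0 <= n c by rewrite mulr_ge0 ?expR_ge0 ?l2norm_ge0.
have cu : C01 (fun z => expR (delta * c) * x c z).
  by apply: within_mul => //; exact: within_cst.
have cw : C01 (fun z => n c * psi z) by apply: within_mul => //; exact: within_cst.
have w0 z : z \in `[0, 1] -> 0 <= n c * psi z.
  by move=> zI; rewrite mulr_ge0// barrier_ge0// l2norm_ge0.
have cmp eta (eta0 : 0 < eta) sg (sg1 : `|sg| = 1) :=
  solution_comparison a0 cg0 cg1 AB k0 k1 sol c0 sg1 eta0 nmax.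
have H eta : 0 < eta ->
    int01 (fun z => softsq eta (expR (delta * c) * x c z - n c * psi z)) <=
      int01 (fun z => softsq eta (x 0 z - n c * psi z)) /\
    int01 (fun z => softsq eta (- (expR (delta * c) * x c z) - n c * psi z)) <=
      int01 (fun z => softsq eta (- x 0 z - n c * psi z)).
  move=> eta0; split.
    have := cmp eta eta0 1 (normr1 _).
    by under eq_int01 do rewrite mul1r; under [X in _ <= X]eq_int01 do
      rewrite mulr0 expR0 !mul1r.
  have := cmp eta eta0 (-1) (normrN1 _).
  by under eq_int01 do rewrite mulN1r mulNr; under [X in _ <= X]eq_int01 do
    rewrite mulr0 expR0 mulr1 mulN1r.
have E := int01_sqr_le_excess r0 cu cx0 cw w0 H.
have sqrZ (s : R) (f : R -> R) : C01 f ->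
    int01 (fun z => (s * f z) ^+ 2) = s ^+ 2 * int01 (fun z => f z ^+ 2).
  move=> cf; rewrite -int01Z; last exact: within_mul.
  by apply: eq_int01 => z _; rewrite exprMn.
move: E; rewrite !sqrZ// -!sqr_l2norm -exprMn -/(n c) => E.
apply: (le_trans E); rewrite lerD2r -mulrA ler_pM2l; last lra.
rewrite mulrC ler_wpM2r ?sqr_ge0// sqr_l2norm.
exact: int01_barrier_sqr (l2norm_ge0 _) (l2norm_ge0 _) AB k0 k1.
Qed.

(** [solution_sqr_le] is applied at the point of [[0, T]] where the weighted norm
    is largest. If this is 0, there is no past to compare with, but then the
    bound holds because [1 <= M]. *)
Lemma solution_bound (a k r M : R) (g0 g1 x0 : R -> R) (x : R -> R -> R) :
  let delta := a * k / 4 in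
  0 < a -> C01 g0 -> C01 g1 -> l2norm g0 + l2norm g1 <= 2 -> 0 <= k -> k <= 1 ->
  is_solution a g0 g1 x0 x -> 0 < r -> 1 <= M ->
  1 + r^-1 <=
    (1 - (1 + r) * ((l2norm g0 + l2norm g1) ^+ 2 / 3 + 5 * k)) * M ^+ 2 ->
  (1 + r) * ((l2norm g0 + l2norm g1) ^+ 2 / 3 + 5 * k) < 1 ->
  forall t, 0 <= t -> expR (delta * t) * l2norm (x t) <= M * l2norm (x 0).
Proof.
move=> delta a0 cg0 cg1 AB k0 k1 sol r0 M1 Mr q1 T T0.
pose n t := expR (delta * t) * l2norm (x t).
have cn : {within `[0, T], continuous n}.
  apply: within_mul.
    by apply: continuous_subspaceT; exact: continuous_weight.
  have -> : (fun t => l2norm (x t)) = (fun t => Num.sqrt (int01 (fun z => x t z ^+ 2))).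
    by apply/funext => t; rewrite l2normE.
  apply: (within_post (@sqrt_continuous R)).
  apply: (@int01_continuous R (fun t z => x t z ^+ 2)) => //.
  have cx : {within `[0, T] `*` `[0, 1], continuous (fun p : R * R => x p.1 p.2)}.
    have [cx _] := sol; apply: continuous_subspaceW cx => -[t z] [/= tI zI].
    by split => //=; move: tI; rewrite !in_itv/=; lra.
  exact: within_mul.
have [c cI nmax] := EVT_max T0 cn.
have nT : n T <= n c by apply: nmax; rewrite in_itv/= T0 lexx.
apply: (le_trans nT); have [c0 cT] : 0 <= c /\ c <= T.
  by move: cI; rewrite in_itv/= => /andP.
have nx0 := l2norm_ge0 (x 0).
move: c0; rewrite le_eqVlt => /predU1P[c0|c0].
  by rewrite -c0 /n mulr0 expR0 mul1r ler_peMl.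
have nmax' t : t \in `[0, c] -> n t <= n c.
  by move=> tI; apply: nmax; move: tI; rewrite !in_itv/=; lra.
have := solution_sqr_le a0 cg0 cg1 AB k0 k1 sol r0 c0 nmax'.
rewrite -/delta -/(n c); move: q1 Mr.
set q := (1 + r) * _ => q1 Mr E.
have nc0 : 0 <= n c by rewrite mulr_ge0 ?expR_ge0 ?l2norm_ge0.
have M0 : 0 <= M * l2norm (x 0) by rewrite mulr_ge0//; lra.
rewrite -ler_sqr ?nnegrE//.
have q1' : 0 < 1 - q by rewrite subr_gt0.
rewrite -(ler_pM2l q1') [X in _ <= _ * X]exprMn.
have : (1 + r^-1) * l2norm (x 0) ^+ 2 <= (1 - q) * M ^+ 2 * l2norm (x 0) ^+ 2.
  by rewrite ler_wpM2r// sqr_ge0.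
lra.
Qed.

End small_gain.

Unset Implicit Arguments.

Theorem theorem3p2 (R : realType) (a : R) (g0 g1 : R -> R)
    (Delta : set (R -> R)) :
  0 < a ->
  Ck_on 1 `[0, 1] g0 ->
  Ck_on 1 `[0, 1] g1 ->
  admissible a g0 g1 Delta ->
  Num.sqrt (int01 (fun z => g0 z ^+ 2)) + Num.sqrt (int01 (fun z => g1 z ^+ 2))
    < Num.sqrt 3 ->
  exists M delta : R, 0 < M /\ 0 < delta /\
    forall x0, Delta x0 ->
      forall x : R -> R -> R, is_solution a g0 g1 x0 x ->
        forall t, 0 <= t ->
          l2norm (x t) <= M * expR (- delta * t) * l2norm (x 0).
Proof.
move=> a0 [g0' [dg0 _]] [g1' [dg1 _]] _; rewrite -!l2normE.
have cg0 := has_deriv_within_continuous dg0.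
have cg1 := has_deriv_within_continuous dg1.
have A0 := l2norm_ge0 g0; have B0 := l2norm_ge0 g1 => AB3.
set S := l2norm g0 + l2norm g1 in AB3.
have S0 : 0 <= S by exact: addr_ge0.
have S3 : S ^+ 2 < 3.
  have three0 : 0 <= 3 :> R by [].
  by rewrite -(sqr_sqrtr three0) ltr_sqr ?nnegrE// sqrtr_ge0.
have AB : S <= 2 by rewrite -ler_sqr ?nnegrE//; lra.
pose q0 := S ^+ 2 / 3.
have q00 : 0 <= q0 by rewrite divr_ge0// sqr_ge0.
have q01 : q0 < 1 by rewrite /q0; lra.
(* [k] takes half of the margin [1 - q0], so that the squared norm of the
   barrier is at most [q < 1], and [r] leaves [(1 + r) * q < 1]. *)
pose k := (1 - q0) / 10; pose q := (1 + q0) / 2; pose r := (1 - q) / 2.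
have qE : q0 + 5 * k = q by rewrite /q /k; field.
have k0 : 0 < k by rewrite /k; lra.
have k1 : k <= 1 by rewrite /k; lra.
have q1 : q < 1 by rewrite /q; lra.
have qpos : 0 <= q by rewrite /q; lra.
have r0 : 0 < r by rewrite /r; lra.
have rq : (1 + r) * q < 1.
  have : 0 < (1 - q) * (1 - q / 2) by rewrite mulr_gt0//; lra.
  by rewrite /r; lra.
have D0 : 0 < 1 - (1 + r) * q by rewrite subr_gt0.
have r10 : 0 < r^-1 by rewrite invr_gt0.
(* [M ^+ 2] must dominate the quotient, and [1 <= M]; adding 1 to the quotient
   ensures both. *)
pose M := 1 + (1 + r^-1) / (1 - (1 + r) * q).
have N0 : 0 <= (1 + r^-1) / (1 - (1 + r) * q) by rewrite divr_ge0//; lra.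
have M1 : 1 <= M by rewrite /M lerDl.
have MM : 1 + r^-1 <= (1 - (1 + r) * q) * M ^+ 2.
  have : (1 + r^-1) / (1 - (1 + r) * q) <= M ^+ 2.
    rewrite /M; move: ((1 + r^-1) / (1 - (1 + r) * q)) N0 => N N0.
    by have := sqr_ge0 N; nra.
  by rewrite ler_pdivrMr// mulrC.
exists M, (a * k / 4); split; first lra.
have ak : 0 < a * k by exact: mulr_gt0.
split; first lra.
move=> x0 _ x sol t t0.
have := solution_bound a0 cg0 cg1 AB (ltW k0) k1 sol r0 M1.
rewrite -/S -/q0 qE => /(_ MM rq t t0) bnd.
have e0 := expR_gt0 (a * k / 4 * t).
by rewrite mulNr expRN mulrAC ler_pdivlMr// mulrC.
Qed.
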